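(* Let $(\mathcal{X},\mathcal{D})$ be a strongly connected digraph. Let $h\colon\mathcal{D}\to\mathcal{X}$, $h(x_1,x_2)=x_2$, let $H_{\mathcal{D}}=\{(e,e')\in\mathcal{D}^2\colon e=(x_1,x_2),\ e'=(x_1',x_2'),\ x_2=x_1'\}$, and let $H(e,e')=1$ if $(e,e')\in H_{\mathcal{D}}$ and $H(e,e')=0$ otherwise. Then the Hudson expansion $$H_\star\colon\mathcal{W}(\mathcal{X},\mathcal{D})\to\mathcal{W}_h(\mathcal{D},H_{\mathcal{D}}),\qquad H_\star\bar P(e,e')=H(e,e')\,\bar P(h(e),h(e')),$$ is a Markov embedding (with associated lumping function $h$) that is congruent with the Hudson lumping $h$, i.e. $h_\star H_\star\bar P=\bar P$.
   Context: All vertex sets are finite with at least two elements. For a strongly connected digraph $(\mathcal{Y},\mathcal{E})$, $\mathcal{F}_+(\mathcal{Y},\mathcal{E})$ is the set of functions $\mathcal{Y}^2\to\mathbb{R}$ strictly positive on $\mathcal{E}$ and zero outside; $\mathcal{W}(\mathcal{Y},\mathcal{E})$ is the set of $P\in\mathcal{F}_+(\mathcal{Y},\mathcal{E})$ whose rows sum to $1$. For a surjective map (lumping function) $\kappa\colon\mathcal{Y}\to\mathcal{X}$, put $\mathcal{S}_x=\kappa^{-1}(\{x\})$, $\kappa_2(y,y')=(\kappa(y),\kappa(y'))$. $P\in\mathcal{W}(\mathcal{Y},\mathcal{E})$ is $\kappa$-lumpable if $\sum_{y'\in\mathcal{S}_{x'}}P(y_1,y')=\sum_{y'\in\mathcal{S}_{x'}}P(y_2,y')$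 for all $x,x'\in\mathcal{X}$, $y_1,y_2\in\mathcal{S}_x$; the common value is denoted $\kappa_\star P(x,x')$. $\mathcal{W}_\kappa(\mathcal{Y},\mathcal{E})$ is the set of $\kappa$-lumpable elements of $\mathcal{W}(\mathcal{Y},\mathcal{E})$. Markov embedding: a map $\Lambda_\star\colon\mathcal{W}(\mathcal{X},\mathcal{D})\to\mathcal{W}(\mathcal{Y},\mathcal{E})$, $\Lambda_\star P(y,y')=P(\kappa(y),\kappa(y'))\Lambda(y,y')$ for $(y,y')\in\mathcal{E}$ (and $0$ otherwise), where (i) $\kappa\colon\mathcal{Y}\to\mathcal{X}$ is surjective with $\kappa_2(\mathcal{E})=\mathcal{D}$, and for every $(x,x')\in\mathcal{D}$ and $y\in\mathcal{S}_x$ there is $y'\in\mathcal{S}_{x'}$ with $(y,y')\in\mathcal{E}$; (ii) $\Lambda\in\mathcal{F}_+(\mathcal{Y},\mathcal{E})$; (iii) for all $y\in\mathcal{Y}$, $x'\in\mathcal{X}$ with $(\kappa(y),x')\in\mathcal{D}$, $(\Lambda(y,y'))_{y'\in\mathcal{S}_{x'}}$ is a probability distribution on $\mathcal{S}_{x'}$. In the theorem, $\mathcal{Y}=\mathcal{D}$, $\mathcal{E}=H_{\mathcal{D}}$, $\kappa=h$, $\Lambda=H$. *)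

(* Defs.v *)
From mathcomp Require Import all_boot all_order all_algebra.
From mathcomp Require Import classical_sets functions reals.

Set Implicit Arguments.
Unset Strict Implicit.
Unset Printing Implicit Defensive.

Import Order.TTheory GRing.Theory Num.Theory.
Local Open Scope ring_scope.

(* Digraphs on V are given by their edge set E; loops are allowed.            *)
Definition strongly_connected (V : finType) (E : {set V * V}) : Prop :=
  forall x y : V, connect [rel u v | (u, v) \in E] x y.

Definition sc_digraph (V : finType) (E : {set V * V}) : Prop :=
  (1 < #|V|)%N /\ strongly_connected E.

(* Fpos, stoch and stoch_lumpable are the classes F_+, W and W_kappa.         *)
Definition Fpos (R : realType) (V : finType) (E : {set V * V}) :
    set {ffun V * V -> R} :=
  fun f => (forall e, e \in E -> 0 < f e) /\ (forall e, e \notin E -> f e = 0).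

Definition stoch (R : realType) (V : finType) (E : {set V * V}) :
    set {ffun V * V -> R} :=
  fun P => Fpos E P /\ (forall x : V, \sum_(x' : V) P (x, x') = 1).

Definition fiber (X Y : finType) (kappa : Y -> X) (x : X) : {set Y} :=
  kappa @^-1: [set x].

Definition kappa2 (X Y : finType) (kappa : Y -> X) (e : Y * Y) : X * X :=
  (kappa e.1, kappa e.2).

Definition lumpable (R : realType) (X Y : finType) (kappa : Y -> X)
    (P : {ffun Y * Y -> R}) : Prop :=
  forall (x x' : X) (y1 y2 : Y), y1 \in fiber kappa x -> y2 \in fiber kappa x ->
    \sum_(y' in fiber kappa x') P (y1, y') =
    \sum_(y' in fiber kappa x') P (y2, y').

Definition stoch_lumpable (R : realType) (X Y : finType) (kappa : Y -> X)
    (E : {set Y * Y}) : set {ffun Y * Y -> R} :=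
  fun P => stoch E P /\ lumpable kappa P.

(* The lumped kernel kappa_* P. The block sum is evaluated at an arbitrary    *)
(* representative y of the fiber of x: the choice is immaterial when P is     *)
(* kappa-lumpable, and the default 0 is not reached when kappa is surjective. *)
Definition lump (R : realType) (X Y : finType) (kappa : Y -> X)
    (P : {ffun Y * Y -> R}) : {ffun X * X -> R} :=
  [ffun e : X * X =>
     (if [pick y in fiber kappa e.1] is Some y
      then \sum_(y' in fiber kappa e.2) P (y, y') else 0) : R].

(* F, restricted to W(X, D), is the Markov embedding into W(Y, E) with        *)
(* lumping function kappa and coefficients Lambda. Its values outside         *)
(* W(X, D) are irrelevant.                                                    *)
Record markov_embedding (R : realType) (X Y : finType)
    (D : {set X * X}) (E : {set Y * Y}) (kappa : Y -> X)
    (Lambda : {ffun Y * Y -> R})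
    (F : {ffun X * X -> R} -> {ffun Y * Y -> R}) : Prop := MarkovEmbedding {
  me_dom : sc_digraph D;
  me_codom : sc_digraph E;
  me_map : set_fun (stoch D) (stoch E) F;
  me_surj : forall x : X, exists y : Y, kappa y = x;
  me_edges : kappa2 kappa @: E = D;
  me_lift : forall (x x' : X) (y : Y), (x, x') \in D -> y \in fiber kappa x ->
    exists2 y' : Y, y' \in fiber kappa x' & (y, y') \in E;
  me_pos : Fpos E Lambda;
  me_prob : forall (y : Y) (x' : X), (kappa y, x') \in D ->
    (forall y', y' \in fiber kappa x' -> 0 <= Lambda (y, y')) /\
    \sum_(y' in fiber kappa x') Lambda (y, y') = 1;
  me_formula : forall P, stoch D P -> forall y y' : Y,
    F P (y, y') =
      if (y, y') \in E then P (kappa y, kappa y') * Lambda (y, y') else 0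
}.

Definition edge (X : finType) (D : {set X * X}) : finType :=
  {e : X * X | e \in D}.

Definition hudson (X : finType) (D : {set X * X}) (e : edge D) : X :=
  (val e).2.

Definition hudson_edges (X : finType) (D : {set X * X}) :
    {set edge D * edge D} :=
  [set ee : edge D * edge D | (val ee.1).2 == (val ee.2).1].

Definition hudson_kernel (R : realType) (X : finType) (D : {set X * X}) :
    {ffun edge D * edge D -> R} :=
  [ffun ee => if ee \in hudson_edges D then 1 else 0].

Definition hudson_expansion (R : realType) (X : finType) (D : {set X * X})
    (P : {ffun X * X -> R}) : {ffun edge D * edge D -> R} :=
  [ffun ee => hudson_kernel R D ee * P (hudson ee.1, hudson ee.2)].

(* Main.v *)
(** An edge [e] and a vertex [x'] determine at most one edge [e'] that follows
    [e] and ends at [x'], namely [(h e, x')]. Hence each block sum of the Hudson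
    kernel has at most one nonzero term, which gives the row sums, lumpability
    and congruence at once. Strong connectedness of the edge digraph follows by
    lifting a path from the head of [e] to the tail of [e'], vertex by vertex. *)

Require Import Defs.
From mathcomp Require Import all_boot all_order all_algebra.
From mathcomp Require Import classical_sets functions reals.


Set Implicit Arguments.
Unset Strict Implicit.
Unset Printing Implicit Defensive.

Import Order.TTheory GRing.Theory Num.Theory.
Local Open Scope ring_scope.

(** A path to [x] from some other vertex is nonempty, and its last edge enters [x]. The other vertex
    exists because there are at least two. *)
Lemma sc_digraph_in_edge (X : finType) (D : {set X * X}) :
  sc_digraph D -> forall x : X, exists w : X, (w, x) \in D.
Proof.
move=> [/card_gt1P[a [b [_ _ ab]]] scD] x.
have [y yx] : exists y : X, y != x.
  by have [ax|ax] := eqVneq a x; [exists b; rewrite -ax eq_sym | exists a].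
have /connectP[p] := scD y x.
case/lastP: p => [|p z] /=; first by move=> _ xy; rewrite xy eqxx in yx.
rewrite rcons_path last_rcons => /andP[_ zD] ->.
by exists (last y p).
Qed.

Lemma hudson_surj (X : finType) (D : {set X * X}) :
  sc_digraph D -> forall x : X, exists e : edge D, hudson e = x.
Proof.
move=> scD x; have [w wx] := sc_digraph_in_edge scD x.
by exists (exist _ (w, x) wx).
Qed.

Lemma connect_hudson_edges (X : finType) (D : {set X * X}) (e e' : edge D) :
  connect [rel u v | (u, v) \in D] (hudson e) (val e').1 ->
  connect [rel u v | (u, v) \in hudson_edges D] e e'.
Proof.
move=> /connectP[p]; elim: p e => [|z p IHp] e /=.
  (* With an empty path the head of [e] is already the tail of [e'], so one step leads from [e] to
     [e']. *)
  by move=> _ ee'; apply: connect1; rewrite /= inE /= ee'.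
move=> /andP[ez pz] plast.
(* The first edge of the path follows [e] and has head [z], where the rest of the path starts. *)
pose f : edge D := exist _ (hudson e, z) ez.
apply: (@connect_trans _ _ f); last exact: IHp.
by apply: connect1; rewrite /= inE.
Qed.

Lemma sc_hudson_edges (X : finType) (D : {set X * X}) :
  sc_digraph D -> sc_digraph (hudson_edges D).
Proof.
move=> scD; split; last by move=> e e'; apply/connect_hudson_edges/scD.2.
have [/card_gt1P[a [b [_ _ ab]]] _] := scD.
(* Edges entering two distinct vertices are distinct, so [D] has at least two elements. *)
have [e ea] := hudson_surj scD a; have [f fb] := hudson_surj scD b.
apply/card_gt1P; exists e, f; split=> //.
by apply: contraNneq ab => ef; rewrite -ea -fb ef.
Qed.

Lemma kappa2_hudson_edge (X : finType) (D : {set X * X})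
    (ee : edge D * edge D) :
  ee \in hudson_edges D -> kappa2 (@hudson X D) ee \in D.
Proof.
case: ee => e [[y z] yz]; rewrite inE /= => /eqP ey.
by rewrite /kappa2 /= /hudson ey.
Qed.

Lemma kappa2_hudson_edges (X : finType) (D : {set X * X}) :
  sc_digraph D -> kappa2 (@hudson X D) @: hudson_edges D = D.
Proof.
move=> scD; apply/setP => -[x x']; apply/imsetP/idP.
  by move=> [ee eeE ->]; apply: kappa2_hudson_edge.
move=> xx'; have [e ex] := hudson_surj scD x.
pose f : edge D := exist _ (x, x') xx'.
by exists (e, f); rewrite ?inE /kappa2 /= ?ex // -ex.
Qed.

Lemma hudson_kernel_ge0 (R : realType) (X : finType) (D : {set X * X}) ee :
  0 <= hudson_kernel R D ee.
Proof. by rewrite ffunE; case: ifP. Qed.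

Lemma Fpos_hudson_kernel (R : realType) (X : finType) (D : {set X * X}) :
  Fpos (hudson_edges D) (hudson_kernel R D).
Proof.
by split=> ee; rewrite ffunE; [move=> -> | move/negPf ->].
Qed.

Lemma hudson_kernel_block_sum (R : realType) (X : finType) (D : {set X * X})
    (e : edge D) (x' : X) :
  \sum_(e' in fiber (@hudson X D) x') hudson_kernel R D (e, e') =
  ((hudson e, x') \in D)%:R.
Proof.
(* The only candidate for a nonzero term; it is an edge exactly when the right-hand side is 1. *)
have follow e' : e' \in fiber (@hudson X D) x' ->
    (e, e') \in hudson_edges D -> val e' = (hudson e, x').
  by rewrite !inE /hudson; case: e' => -[y z] /= _ /eqP-> /eqP->.
have [ex'|ex'] := boolP ((hudson e, x') \in D); last first.
  rewrite big1// => e' e'x'; rewrite ffunE ifN//.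
  by apply: contra ex' => /(follow _ e'x') <-; apply: valP.
pose f : edge D := exist _ (hudson e, x') ex'.
rewrite (bigD1 f) /=; last by rewrite !inE.
rewrite ffunE inE /= eqxx big1 ?addr0// => e' /andP[e'x' e'f].
rewrite ffunE ifN//; apply: contra e'f => /(follow _ e'x') e'E.
by apply/eqP/val_inj.
Qed.

(** On a block the factor [P (hudson e, x')] is constant and leaves the sum. The remaining kernel
    sum is 1 on [D], and off [D] both sides vanish. *)
Lemma hudson_expansion_block_sum (R : realType) (X : finType)
    (D : {set X * X}) (P : {ffun X * X -> R}) (e : edge D) (x' : X) :
  Fpos D P ->
  \sum_(e' in fiber (@hudson X D) x') hudson_expansion D P (e, e') =
  P (hudson e, x').
Proof.
move=> [_ P0].
transitivity (\sum_(e' in fiber (@hudson X D) x')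
                hudson_kernel R D (e, e') * P (hudson e, x')).
  by apply: eq_bigr => e'; rewrite !inE ffunE => /eqP <-.
rewrite -mulr_suml hudson_kernel_block_sum.
by have [_|/P0->] := boolP (_ \in D); rewrite ?mul1r ?mulr0.
Qed.

Lemma Fpos_hudson_expansion (R : realType) (X : finType) (D : {set X * X})
    (P : {ffun X * X -> R}) :
  Fpos D P -> Fpos (hudson_edges D) (hudson_expansion D P).
Proof.
move=> [Ppos _]; have [Kpos K0] := Fpos_hudson_kernel R D.
split=> ee eeE; rewrite ffunE; last by rewrite K0 ?mul0r.
by apply: mulr_gt0; [exact: Kpos | apply/Ppos/kappa2_hudson_edge].
Qed.

Lemma stoch_hudson_expansion (R : realType) (X : finType) (D : {set X * X})
    (P : {ffun X * X -> R}) :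
  stoch D P -> stoch (hudson_edges D) (hudson_expansion D P).
Proof.
move=> [FP P1]; split; first exact: Fpos_hudson_expansion.
(* Grouping the row of [e] by heads turns it, block by block, into the row of [P] at [hudson e]. *)
move=> e; rewrite -(P1 (hudson e)) (partition_big (@hudson X D) predT) //=.
apply: eq_bigr => x' _; rewrite -hudson_expansion_block_sum //.
by apply: eq_bigl => e'; rewrite !inE.
Qed.

(** The block sums from [e] depend on [e] only through [hudson e]. *)
Lemma lumpable_hudson_expansion (R : realType) (X : finType) (D : {set X * X})
    (P : {ffun X * X -> R}) :
  Fpos D P -> lumpable (@hudson X D) (hudson_expansion D P).
Proof.
move=> FP x x' e1 e2; rewrite !inE => /eqP e1x /eqP e2x.
by rewrite !hudson_expansion_block_sum // e1x e2x.
Qed.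

Lemma lump_hudson_expansion (R : realType) (X : finType) (D : {set X * X})
    (P : {ffun X * X -> R}) :
  sc_digraph D -> Fpos D P -> lump (@hudson X D) (hudson_expansion D P) = P.
Proof.
move=> scD FP; apply/ffunP => -[x x']; rewrite ffunE /=.
case: pickP => [e|fib0].
  by rewrite !inE => /eqP ex; rewrite hudson_expansion_block_sum // ex.
(* The default value in [lump] would require an empty fiber, which surjectivity of [hudson]
   excludes. *)
by have [e ex] := hudson_surj scD x; have := fib0 e; rewrite !inE ex eqxx.
Qed.

Lemma markov_embedding_hudson (R : realType) (X : finType) (D : {set X * X}) :
  sc_digraph D ->
  markov_embedding D (hudson_edges D) (@hudson X D) (hudson_kernel R D)
    (@hudson_expansion R X D).
Proof.
move=> scD; split=> //.
- exact: sc_hudson_edges.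
- by move=> P; apply: stoch_hudson_expansion.
- exact: hudson_surj.
- exact: kappa2_hudson_edges.
- move=> x x' e xx'; rewrite !inE => /eqP ex.
  (* The edge [(x, x')] is itself the lift: it follows every edge with head [x]. *)
  by exists (exist _ (x, x') xx'); rewrite !inE //= -ex.
- exact: Fpos_hudson_kernel.
- move=> e x' ex'; rewrite hudson_kernel_block_sum ex'.
  by split=> // e' _; apply: hudson_kernel_ge0.
- move=> P _ e e'; rewrite !ffunE /=.
  by case: ifP; rewrite ?mul0r // mulrC.
Qed.

Theorem theorem4p4 (R : realType) (X : finType) (D : {set X * X})
    (hD : sc_digraph D) :
  [/\ set_fun (stoch D) (stoch_lumpable (@hudson X D) (hudson_edges D))
        (@hudson_expansion R X D),
      markov_embedding D (hudson_edges D) (@hudson X D) (hudson_kernel R D)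
        (@hudson_expansion R X D)
    & forall P : {ffun X * X -> R}, stoch D P ->
        lump (@hudson X D) (hudson_expansion D P) = P].
Proof.
split; last by move=> P [FP _]; apply: lump_hudson_expansion.
- move=> P stP; split; first exact: stoch_hudson_expansion.
  by apply: lumpable_hudson_expansion; case: stP.
- exact: markov_embedding_hudson.
Qed.
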